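(* There exists a function $\varepsilon:(1,\infty)\to\mathbb{R}$ with $\varepsilon(\rho)\to 0$ as $\rho\to\infty$ such that every finite triangle-free graph $G$ with $\rho(G)>1$ satisfies $$\chi_f(G)\le (1+\varepsilon(\rho(G)))\frac{\rho(G)}{\ln \rho(G)}.$$
   Context: $\rho(G)$ denotes the spectral radius of the adjacency matrix of $G$. The fractional chromatic number $\chi_f(G)$ is the minimum real number $r\ge 1$ such that there exists a probability distribution on the independent sets of $G$ under which a random independent set contains every vertex with probability at least $1/r$. A graph is triangle-free if it contains no three pairwise adjacent vertices. *)

(* Defs.v *)
From mathcomp Require Import all_boot all_order all_algebra.
From mathcomp Require Import all_classical all_reals all_analysis.
From mathcomp.real_closed Require Import complex.

Set Implicit Arguments.
Unset Strict Implicit.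
Unset Printing Implicit Defensive.
Import Order.TTheory GRing.Theory Num.Theory.
Import numFieldNormedType.Exports.

Local Open Scope classical_set_scope.
Local Open Scope ring_scope.

(* A finite simple graph is a symmetric irreflexive e : rel T, T a finType. *)

Definition triangle_free (T : finType) (e : rel T) : Prop :=
  forall x y z : T, ~~ [&& e x y, e y z & e x z].

Definition independent (T : finType) (e : rel T) (I : {set T}) : bool :=
  [forall x in I, forall y in I, ~~ e x y].

Definition adjacency_mx (R : realType) (T : finType) (e : rel T) :
    'M[R]_#|T| :=
  \matrix_(i, j) (e (enum_val i) (enum_val j))%:R.

(* The largest modulus of a complex eigenvalue; 0 for the 0 x 0 matrix. *)
Definition spectral_radius (R : realType) (n : nat) (A : 'M[R]_n) : R :=
  sup [set ComplexField.Normc.normc z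
      | z in [set z : R[i] | eigenvalue (map_mx (real_complex R) A) z]].

Definition graph_spectral_radius (R : realType) (T : finType) (e : rel T) : R :=
  spectral_radius (adjacency_mx R e).

Definition indep_distribution (R : realType) (T : finType) (e : rel T)
    (P : {ffun {set T} -> R}) : Prop :=
  [/\ forall I, 0 <= P I,
      forall I, ~~ independent e I -> P I = 0
    & \sum_(I : {set T}) P I = 1].

Definition fractional_colorable (R : realType) (T : finType) (e : rel T)
    (r : R) : Prop :=
  1 <= r /\ exists2 P : {ffun {set T} -> R}, indep_distribution e P
          & forall x : T, r^-1 <= \sum_(I : {set T} | x \in I) P I.

(* The minimum r; it is attained when e is irreflexive, by
   fractional_chromatic_min. *)
Definition fractional_chromatic (R : realType) (T : finType) (e : rel T) : R :=
  inf [set r : R | fractional_colorable e r].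

Lemma fractional_colorable_card (R : realType) (T : finType) (e : rel T) :
  irreflexive e -> fractional_colorable e (#|T|.+1%:R : R).
Proof.
move=> irr; split; first by rewrite ler1n.
pose c : R := #|T|.+1%:R^-1.
have c0 : 0 <= c by rewrite invr_ge0.
exists [ffun I : {set T} =>
  c * ((I == finset.set0)%:R + \sum_x (I == [set x]%SET)%:R)].
  split=> [I|I|].
  - by rewrite ffunE mulr_ge0// addr_ge0// sumr_ge0.
  - rewrite ffunE => nI.
    have -> : (I == finset.set0) = false.
      apply/eqP => I0; move: nI; rewrite I0 => /negP; apply.
      by apply/forallP => x; rewrite finset.in_set0.
    rewrite big1 ?addr0 ?mulr0// => x _.
    case: eqP => // Ix; move: nI; rewrite Ix => /negP[].
    apply/forall_inP => y /set1P ->; apply/forall_inP => z /set1P ->.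
    by rewrite irr.
  - under eq_bigr do rewrite ffunE.
    rewrite -big_distrr /= big_split /= exchange_big /=.
    have E (J : {set T}) : \sum_(I : {set T}) (I == J)%:R = 1 :> R.
      by rewrite (bigD1 J)//= eqxx big1 ?addr0// => I /negbTE ->.
    rewrite E (eq_bigr (fun=> 1))// sumr_const cardT -cardE nat1r.
    by rewrite mulVf// pnatr_eq0.
move=> x; rewrite (bigD1 [set x]%SET) ?finset.set11//= ffunE.
rewrite -/c (bigD1 x)//= eqxx.
have -> : ([set x]%SET == finset.set0) = false by rewrite -finset.cards_eq0 finset.cards1.
rewrite mulrDr mulrDr mulr1 mulr0 add0r -addrA lerDl addr_ge0//.
  by rewrite mulr_ge0// sumr_ge0.
by apply: sumr_ge0 => I _; rewrite ffunE mulr_ge0// addr_ge0// sumr_ge0.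
Qed.

Lemma fractional_chromatic_min (R : realType) (T : finType) (e : rel T) :
  irreflexive e ->
  fractional_colorable e (fractional_chromatic R e) /\
  forall r : R, fractional_colorable e r -> fractional_chromatic R e <= r.
Proof.
move=> irr.
set S := [set r : R | fractional_colorable e r].
have S0 : S !=set0 by exists #|T|.+1%:R; exact: fractional_colorable_card.
have lbS : has_lbound S by exists 1 => r [].
split; last by move=> r Sr; exact: (ge_inf lbS).
pose N := #|{set T}|.
pose h (P : {ffun {set T} -> R}) : 'rV[R]_N := \row_i P (enum_val i).
pose g (v : 'rV[R]_N) : {ffun {set T} -> R} :=
  [ffun I => v ord0 (enum_rank I)].
have hK P : g (h P) = P.
  by apply/ffunP => I; rewrite ffunE mxE enum_rankK.
pose A := [set v : 'rV[R]_N | indep_distribution e (g v)].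
pose p (v : 'rV[R]_N) x := \sum_(I : {set T} | x \in I) g v I.
pose f v := \big[Num.min/1]_(x : T) p v x.
have cg I : continuous (fun v : 'rV[R]_N => g v I).
  have -> : (fun v => g v I) = (fun v : 'rV[R]_N => v ord0 (enum_rank I)).
    by apply/funext => v; rewrite ffunE.
  exact: coord_continuous.
have csum (Q : pred {set T}) :
    continuous (fun v : 'rV[R]_N => \sum_(I : {set T} | Q I) g v I).
  elim: (index_enum _) => [|J s IHs].
    have -> : (fun v : 'rV[R]_N => \sum_(I <- [::] | Q I) g v I) = fun=> 0.
      by apply/funext => v; rewrite big_nil.
    exact: cst_continuous.
  have [QJ|QJ] := boolP (Q J); last first.
    suff -> : (fun v : 'rV[R]_N => \sum_(I <- J :: s | Q I) g v I) =
        fun v => \sum_(I <- s | Q I) g v I by [].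
    by apply/funext => v; rewrite big_cons (negbTE QJ).
  have -> : (fun v : 'rV[R]_N => \sum_(I <- J :: s | Q I) g v I) =
      fun v => g v J + \sum_(I <- s | Q I) g v I.
    by apply/funext => v; rewrite big_cons QJ.
  by move=> v; exact: (cvgD (cg J v) (IHs v)).
have cf : continuous f.
  rewrite /f; elim: (index_enum _) => [|x s IHs].
    have -> : (fun v : 'rV[R]_N => \big[Num.min/1]_(y <- [::]) p v y) = fun=> 1.
      by apply/funext => v; rewrite big_nil.
    exact: cst_continuous.
  have -> : (fun v : 'rV[R]_N => \big[Num.min/1]_(y <- x :: s) p v y) =
      (p^~ x) \min (fun v => \big[Num.min/1]_(y <- s) p v y).
    by apply/funext => v; rewrite big_cons.
  by move=> v; apply: continuous_min; [exact: csum|exact: IHs].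
have clA : closed A.
  rewrite (_ : A = (\bigcap_I [set v | 0 <= g v I]) `&`
    (\bigcap_(I in [set I | ~~ independent e I]) [set v | g v I = 0]) `&`
    [set v | \sum_(I : {set T}) g v I = 1]); last first.
    apply/seteqP; split => v.
      by move=> [a b c]; split => //; split => I /= => [_|]; [exact: a|exact: b].
    by move=> [[a b] c]; split => [I|I|]; [exact: a|exact: b|exact: c].
  apply: closedI; first apply: closedI.
  - apply: closed_bigI => I _.
    apply: (@preimage_closed _ _ (fun v => g v I) [set x | 0 <= x]).
      by move=> v _; exact: cg.
    exact: closed_ge.
  - apply: closed_bigI => I _.
    apply: (@preimage_closed _ _ (fun v => g v I) [set x | x = 0]).
      by move=> v _; exact: cg.
    exact: closed_eq.
  - apply: (@preimage_closed _ _ (fun v => \sum_I g v I) [set x | x = 1]).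
      by move=> v _; exact: (csum xpredT).
    exact: closed_eq.
have cA : compact A.
  have cK : compact [set v : 'rV[R]_N | forall i, v ord0 i \in `[0, 1]].
    apply: (@rV_compact _ _ (fun=> `[(0 : R), 1]%classic)) => _.
    exact: segment_compact.
  apply: subclosed_compact clA cK _.
  move=> v [a _ c] i; rewrite in_itv/=.
  have E : v ord0 i = g v (enum_val i) by rewrite ffunE enum_valK.
  rewrite E a/= -c (bigD1 (enum_val i))//= lerDl; exact: sumr_ge0.
have fP v (r : R) : 1 <= r -> (forall x, r^-1 <= p v x) -> r^-1 <= f v.
  move=> r1 rp; rewrite /f; apply/bigmin_geP; split => [|x _]; last exact: rp.
  by rewrite invf_le1// (lt_le_trans ltr01).
have [r1 [P0 AP0 P0r]] := fractional_colorable_card R irr.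
have [||c] := @EVT_max_rV R N f A _ cA.
- by exists (h P0); rewrite /A /= hK.
- exact: continuous_subspaceT.
rewrite inE => Ac maxc.
have f0 : 0 < f c.
  apply: (@lt_le_trans _ _ #|T|.+1%:R^-1); first by rewrite invr_gt0 ltr0n.
  apply: (le_trans _ (maxc (h P0) _)); last by rewrite inE /A /= hK.
  by apply: fP => // x; rewrite /p hK.
have f1 : f c <= 1 by exact: bigmin_le_id.
have Sc : S (f c)^-1.
  split; first by rewrite invf_ge1.
  exists (g c) => // x; rewrite invrK; exact: bigmin_le.
suff -> : fractional_chromatic R e = (f c)^-1 by [].
apply/eqP; rewrite eq_le (ge_inf lbS Sc)/=.
apply: lb_le_inf => // r [r1' [P AP Pr]].
have r0 : 0 < r by exact: lt_le_trans r1'.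
rewrite -[leRHS]invrK lef_pV2 ?posrE ?invr_gt0//.
apply: (le_trans _ (maxc (h P) _)); last by rewrite inE /A /= hK.
by apply: fP => // x; rewrite /p hK.
Qed.

(* Main.v *)
(* Shearer's random deletion argument, with vertex weights that are updated
   along the way.  For any positive weights x on a triangle-free graph, with
   weighted degrees D_v = (sum of x_u over the neighbours u of v) / x_v, there is
   a random independent set containing each v with probability f(D_v), where
   f(D) = exp(-s) for D = exp(s) (s - 1); note that f(D) ~ ln D / D.

   In an infinitesimal step, vertex z is selected with probability
   proportional to x_z and its neighbours are deleted, while x_u is divided by
   the probability that u survives.  Then x_u is a martingale; as adjacent
   vertices have no common neighbour, D_v behaves well given that v survives.
   Since f is convex and satisfies (D + 1) f + D (D - 1) f' <= 1, the bound
   f(D_v) is preserved on average.  With steps of size d the error per step is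
   O(d^2), uniformly in x, so a gap g in the claimed bound can be improved to
   g - g^2 / 8, and iterating removes it.

   For r larger than the spectral radius, x = (r - A)^-1 1 is positive and
   satisfies A x <= r x, so all weighted degrees are at most r. *)

Require Import Defs.
From mathcomp Require Import all_boot all_order all_algebra.
From mathcomp Require Import all_classical all_reals all_analysis.
From mathcomp.real_closed Require Import complex.
From mathcomp Require Import ring lra.
Set Implicit Arguments.
Unset Strict Implicit.
Unset Printing Implicit Defensive.
Import Order.TTheory GRing.Theory Num.Theory.
Import numFieldNormedType.Exports.
Local Open Scope classical_set_scope.
Local Open Scope ring_scope.

(** * The rate function *)

Lemma expR_mul_subr1_surj (R : realType) (D : R) :
  0 <= D -> exists s, 1 <= s /\ expR s * (s - 1) = D.
Proof.
move=> D0.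
have cf : continuous (fun s : R => expR s * (s - 1)).
  move=> s; apply: cvgM; first exact: continuous_expR.
  by apply: cvgB; [exact: cvg_id|exact: cvg_cst].
have D2 : D <= expR (2 + D) * (2 + D - 1).
  have := expR_ge1Dx (2 + D); nra.
have [||s] := @IVT R (fun s => expR s * (s - 1)) 1 (2 + D) D _
  (continuous_subspaceT cf).
- lra.
- rewrite subrr mulr0; apply/andP; split; first by rewrite ge_min D0.
  by rewrite le_max D2 orbT.
by rewrite in_itv/= => /andP[s1 _] sD; exists s.
Qed.

(** For [D >= 0] this is [1 + W (D / expR 1)], with [W] the principal branch of the Lambert
    function. *)
Definition shearer_exponent (R : realType) (D : R) : R :=
  xget 1 [set s : R | 1 <= s /\ expR s * (s - 1) = D].

(* The supremum over [A >= 1] of [ln A / (A + D)], attained at [A = expR s]. *)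
Definition shearer (R : realType) (D : R) : R := expR (- shearer_exponent D).

Lemma shearer_exponentP (R : realType) (D : R) : 0 <= D ->
  1 <= shearer_exponent D /\
  expR (shearer_exponent D) * (shearer_exponent D - 1) = D.
Proof.
by move=> /expR_mul_subr1_surj; exact: (@xgetPex _ 1
  [set s : R | 1 <= s /\ expR s * (s - 1) = D]).
Qed.

Lemma shearer_le1 (R : realType) (D : R) : 0 <= D -> shearer D <= 1.
Proof.
move=> /shearer_exponentP[s1 _]; rewrite /shearer -expR0 ler_expR; lra.
Qed.

(** Convexity of [shearer] without derivatives: the left side is its tangent line at
    [expR s * (s - 1)]. Choosing [A = expR s] in the supremum bounds [shearer t] below by
    [s / (expR s + t)], which is convex in [t] and has the same tangent there. *)
Lemma shearer_ge_tangent (R : realType) (s t : R) : 1 <= s -> 0 <= t ->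
  2 * expR (- s) - (expR s + t) * expR (- s) ^+ 2 / s <= shearer t.
Proof.
move=> s1 t0; have [u1 ut] := shearer_exponentP t0.
rewrite /shearer; set u := shearer_exponent t in u1 ut *.
have es : expR s * expR (- s) = 1 by rewrite -expRD subrr expR0.
have eu : expR u * expR (- u) = 1 by rewrite -expRD subrr expR0.
have a0 := expR_gt0 s; have b0 := expR_gt0 (- s).
have c0 := expR_gt0 u; have d0 := expR_gt0 (- u).
have h : (1 + (s - u)) * expR u <= expR s.
  rewrite -[leRHS](_ : expR (s - u) * expR u = _); last first.
    by rewrite -expRD subrK.
  by rewrite ler_wpM2r ?expR_ge0// expR_ge1Dx.
(* With [y := expR s + t]: [s * expR u <= y], and [2 z - y z ^+ 2 <= 1 / y]. *)
have y0 : 0 < expR s + t by lra.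
have sy : s * expR u <= expR s + t by rewrite -ut; nra.
apply: (@le_trans _ _ (s / (expR s + t))); last first.
  rewrite ler_pdivrMr//.
  have : s * expR u * expR (- u) <= (expR s + t) * expR (- u) by nra.
  by rewrite -mulrA eu; nra.
rewrite -subr_ge0.
have -> : s / (expR s + t) -
    (2 * expR (- s) - (expR s + t) * expR (- s) ^+ 2 / s) =
    (s - (expR s + t) * expR (- s)) ^+ 2 / (s * (expR s + t)).
  by field; rewrite gt_eqF//= gt_eqF//; lra.
by rewrite divr_ge0 ?sqr_ge0// mulr_ge0//; lra.
Qed.

(** The value at the point of tangency. As the slope is negative, an upper bound on a weighted
    degree becomes a lower bound on [shearer]. *)
Lemma shearer_tangent_eq (R : realType) (s : R) : 1 <= s ->
  2 * expR (- s) - (expR s + expR s * (s - 1)) * expR (- s) ^+ 2 / s =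
  expR (- s).
Proof.
move=> s1; have es : expR s * expR (- s) = 1 by rewrite -expRD subrr expR0.
have -> : (expR s + expR s * (s - 1)) * expR (- s) ^+ 2 / s =
    (expR s * expR (- s)) * expR (- s) by field; lra.
by rewrite es; ring.
Qed.

(* The linear inequality behind Shearer's differential equation: [y] is the
   probability of selecting a vertex of weighted degree [D] and [y * D] the
   probability of killing it. *)
Lemma shearer_step (R : realType) (s y D a k : R) :
  1 <= s -> 0 <= y -> D = expR s * (s - 1) ->
  a = 2 * expR (- s) - expR s * expR (- s) ^+ 2 / s ->
  k = expR (- s) ^+ 2 / s ->
  expR (- s) - (y * D) ^+ 2 <=
    y + (1 - y - y * D) * a - k * (D * (1 - y * D) ^+ 2).
Proof.
move=> s1 y0 DE aE' kE.
have es : expR s * expR (- s) = 1 by rewrite -expRD subrr expR0.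
have b0 := expR_gt0 (- s).
have bl1 : expR (- s) <= 1 by rewrite -expR0 ler_expR; lra.
have s0 : s != 0 by rewrite gt_eqF//; lra.
have aE : a = expR (- s) * (2 - s^-1).
  rewrite aE' expr2 mulrA es mul1r; field; lra.
have kDE : k * D = expR (- s) * (1 - s^-1).
  rewrite kE DE; have -> : expR (- s) ^+ 2 / s * (expR s * (s - 1)) =
    (expR s * expR (- s)) * expR (- s) * (s - 1) / s by ring.
  by rewrite es; field; lra.
have bD : expR (- s) * D = s - 1 by rewrite DE mulrA (mulrC (expR (- s))) es mul1r.
have i0 : 0 < s^-1 by rewrite invr_gt0; lra.
have i1 : s^-1 <= 1 by rewrite invf_le1; lra.
have si : s * s^-1 = 1 by rewrite mulfV.
(* Equivalent to the differential inequality [(D + 1) f + D (D - 1) f' <= 1] with [f = expR (- s)]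
   and [f' = - k]; it follows from [expR (s - 1) >= s] and [expR 1 >= 2]. *)
have e2 : expR (- s) * (2 * s - 1) <= 1.
  rewrite -[leRHS]es mulrC ler_wpM2r ?expR_ge0//.
  have h := expR_ge1Dx (s - 1); have h1 := expR_ge1Dx (1 : R).
  have -> : expR s = expR (s - 1) * expR 1 by rewrite -expRD subrK.
  by nra.
rewrite -subr_ge0.
have -> : y + (1 - y - y * D) * a - k * (D * (1 - y * D) ^+ 2) -
    (expR (- s) - (y * D) ^+ 2) =
    y * s^-1 * (1 - expR (- s) * (2 * s - 1)) + (y * D) ^+ 2 * (1 - k * D).
  rewrite mulrA kDE aE.
  have -> : (1 - y - y * D) * (expR (- s) * (2 - s^-1)) =
    (1 - y) * (expR (- s) * (2 - s^-1)) - y * (expR (- s) * D) * (2 - s^-1) by ring.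
  have -> : expR (- s) * (1 - s^-1) * (1 - y * D) ^+ 2 =
    expR (- s) * (1 - s^-1) - 2 * y * (1 - s^-1) * (expR (- s) * D)
    + expR (- s) * (1 - s^-1) * (y * D) ^+ 2 by ring.
  by rewrite bD; field; lra.
apply: addr_ge0; first by rewrite !mulr_ge0//; lra.
rewrite mulr_ge0 ?sqr_ge0// kDE; nra.
Qed.

(** * Random independent sets *)

Definition dominated (R : realType) (T : finType) (e : rel T) (U : {set T})
    (p : T -> R) : Prop :=
  exists P : {set T} -> R, [/\ forall I, 0 <= P I,
    forall I, ~~ (independent e I && (I \subset U)) -> P I = 0,
    \sum_I P I = 1 &
    forall v, v \in U -> p v <= \sum_(I : {set T} | v \in I) P I].

Lemma dominated_le (R : realType) (T : finType) (e : rel T) (U : {set T})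
    (p q : T -> R) :
  (forall v, v \in U -> q v <= p v) -> dominated e U p -> dominated e U q.
Proof.
move=> qp [P [P0 Ps P1 Pp]]; exists P; split=> // v vU.
by rewrite (le_trans (qp v vU)) ?Pp.
Qed.

Lemma dominated0 (R : realType) (T : finType) (e : rel T) (U : {set T})
    (p : T -> R) :
  (forall v, v \in U -> p v <= 0) -> dominated e U p.
Proof.
move=> p0; exists (fun I => (I == finset.set0)%:R); split=> [I|I||v vU].
- exact: ler0n.
- case: eqP => // -> /negP[]; rewrite finset.sub0set andbT.
  by apply/forallP => x; rewrite finset.in_set0.
- by rewrite (bigD1 finset.set0)//= eqxx big1 ?addr0// => I /negbTE ->.
- by rewrite (le_trans (p0 v vU))// sumr_ge0.
Qed.

(** Add [z] to a random [I] inside [W]: the result stays independent because [W] contains no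
    neighbour of [z]. *)
Lemma dominated_add_vertex (R : realType) (T : finType) (e : rel T)
    (U W : {set T}) (z : T) (p : T -> R) :
  symmetric e -> irreflexive e -> z \in U ->
  W = [set u in U | (u != z) && ~~ e z u]%SET ->
  dominated e W p ->
  dominated e U (fun v => if v == z then 1 else if v \in W then p v else 0).
Proof.
move=> sym irr zU WE [P [P0 Ps P1 Pp]].
have sumP (Q : pred {set T}) :
    \sum_(J | Q J) \sum_(I | z |: I == J) P I = \sum_(I | Q (z |: I)) P I.
  rewrite [RHS](partition_big (fun I => z |: I) Q)//=.
  apply: eq_bigr => J QJ; apply: eq_bigl => I.
  by apply/idP/andP => [/eqP->|[]].
exists (fun J => \sum_(I | z |: I == J) P I); split=> [J|J nJ||v vU].
- exact: sumr_ge0.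
- apply: big1 => I /eqP IJ; apply: Ps; apply: contra nJ => /andP[iI IW].
  have WU : W \subset U by rewrite WE; apply/fintype.subsetP => x; rewrite inE => /andP[].
  rewrite -IJ finset.subUset finset.sub1set zU (fintype.subset_trans IW WU) !andbT.
  have nz x : x \in I -> ~~ e z x.
    by move=> /(fintype.subsetP IW); rewrite WE inE => /and3P[].
  apply/forall_inP => x /finset.setU1P[->|xI]; apply/forall_inP => y
    /finset.setU1P[->|yI]; rewrite ?irr//; [exact: nz|rewrite sym; exact: nz|].
  exact: (forall_inP (forall_inP iI x xI) y yI).
- by rewrite (sumP predT).
rewrite (sumP (fun J : {set T} => v \in J)).
have [->|vz] := eqVneq v z.
  by rewrite -P1 le_eqVlt; apply/orP; left; apply/eqP/eq_bigl => I; rewrite finset.setU11.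
case: ifPn => vW; last exact: sumr_ge0.
rewrite (le_trans (Pp v vW))// le_eqVlt; apply/orP; left; apply/eqP/eq_bigl => I.
by rewrite finset.in_setU1 (negbTE vz).
Qed.

Lemma dominated_mix (R : realType) (T : finType) (e : rel T) (U : {set T})
    (y : T -> R) (p0 : T -> R) (p : T -> T -> R) :
  (forall z, 0 <= y z) -> \sum_(z in U) y z <= 1 ->
  dominated e U p0 -> (forall z, z \in U -> dominated e U (p z)) ->
  dominated e U (fun v => (1 - \sum_(z in U) y z) * p0 v +
                          \sum_(z in U) y z * p z v).
Proof.
move=> y0 y1 [P [P0 Ps P1 Pp]] Q'.
have : forall z, exists Q : {set T} -> R, z \in U ->
    [/\ forall I, 0 <= Q I,
    forall I, ~~ (independent e I && (I \subset U)) -> Q I = 0,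
    \sum_I Q I = 1 &
    forall v, v \in U -> p z v <= \sum_(I : {set T} | v \in I) Q I].
  move=> z; have [/Q'[Q HQ]|_] := boolP (z \in U); first by exists Q.
  by exists P.
move=> /choice[Q HQ].
set c := 1 - _; have c0 : 0 <= c by rewrite subr_ge0.
exists (fun I => c * P I + \sum_(z in U) y z * Q z I).
split=> [I|I nI||v vU].
- rewrite addr_ge0 ?mulr_ge0// sumr_ge0// => z /HQ[Q0 _ _ _].
  by rewrite mulr_ge0.
- rewrite Ps// mulr0 add0r big1// => z /HQ[_ Qs _ _].
  by rewrite Qs// mulr0.
- rewrite big_split/= -big_distrr/= P1 exchange_big/=.
  rewrite (eq_bigr y) ?mulr1 ?subrK// => z /HQ[_ _ Q1 _].
  by rewrite -big_distrr/= Q1 mulr1.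
- rewrite big_split/= -big_distrr/= lerD ?ler_wpM2l ?Pp//.
  rewrite exchange_big/= ler_sum// => z /HQ[_ _ _ Qp].
  by rewrite -big_distrr/= ler_wpM2l ?Qp.
Qed.

(** * The deletion step *)

Definition wdeg (R : realType) (T : finType) (e : rel T) (U : {set T})
    (x : T -> R) (v : T) : R :=
  (\sum_(u in U | e v u) x u) / x v.

Definition survivors (T : finType) (e : rel T) (U : {set T}) (z : T) : {set T} :=
  [set u in U | (u != z) && ~~ e z u]%SET.

Lemma wdeg_ge0 (R : realType) (T : finType) (e : rel T) (U : {set T})
    (x : T -> R) (v : T) : (forall u, 0 < x u) -> 0 <= wdeg e U x v.
Proof.
move=> x0; rewrite divr_ge0 ?(ltW (x0 v))// sumr_ge0// => u _.
exact: ltW.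
Qed.

Lemma sum_survives (R : realType) (T : finType) (e : rel T) (U : {set T})
    (y : T -> R) (v : T) : symmetric e -> irreflexive e -> v \in U ->
  \sum_(z in U | v \in survivors e U z) y z =
  \sum_(z in U) y z - y v - \sum_(z in U | e v z) y z.
Proof.
move=> sym irr vU.
have -> : y v = \sum_(z in U | z == v) y z.
  by rewrite (big_pred1 v)// => z /=; case: eqP => [->|]; rewrite ?vU ?andbF.
apply/eqP; rewrite -addrA -opprD eq_sym subr_eq; apply/eqP.
rewrite !big_mkcondr -!big_split/=; apply: eq_bigr => z zU.
rewrite inE vU/= (sym z) (eq_sym v); have [->|_] := eqVneq z v.
  by rewrite irr add0r addr0.
by case: (e v z); rewrite /= ?add0r ?addr0.
Qed.

(** Selecting [z] removes [u] or [v] exactly when [z] is adjacent to one of them, since [u] and [v]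
    are themselves adjacent. Without triangles no [z] is adjacent to both, so nothing is subtracted
    twice. *)
Lemma sum_both_survive (R : realType) (T : finType) (e : rel T) (U : {set T})
    (y : T -> R) (u v : T) :
  symmetric e -> irreflexive e -> triangle_free e -> u \in U -> v \in U ->
  e v u ->
  \sum_(z in U | (v \in survivors e U z) && (u \in survivors e U z)) y z =
  \sum_(z in U) y z - \sum_(z in U | e v z) y z - \sum_(z in U | e u z) y z.
Proof.
move=> sym irr tf uU vU vu; apply/eqP.
rewrite -addrA -opprD eq_sym subr_eq; apply/eqP.
rewrite !big_mkcondr -!big_split/=; apply: eq_bigr => z zU.
rewrite !inE uU vU/= !(sym z).
have := tf v u z; rewrite vu/= => /negbTE tf'.
have [vz|vz] := boolP (e v z); have [uz|uz] := boolP (e u z).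
- by move: tf'; rewrite vz uz.
- by rewrite andbF/= !add0r addr0.
- by rewrite !andbF !add0r.
have -> : v != z by apply: contraNneq uz => <-; rewrite sym.
have -> : u != z by apply: contraNneq vz => <-.
by rewrite !addr0.
Qed.

(* Dividing [y u] by the survival probability of [u] makes the weight of [u] a
   martingale; since [u] and [v] have no common neighbour, this still holds,
   up to second order, given that [v] survives. *)
Lemma expected_wdeg (R : realType) (T : finType) (e : rel T) (U : {set T})
    (y x : T -> R) (v : T) :
  symmetric e -> irreflexive e -> triangle_free e -> v \in U ->
  (forall u, 0 < y u) -> \sum_(z in U) y z < 1 ->
  (forall u, x u = y u / (1 - \sum_(z in U | e u z) y z)) ->
  \sum_(z in U | v \in survivors e U z) y z * wdeg e (survivors e U z) x v +
    (1 - \sum_(z in U) y z) * wdeg e U x v <=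
  wdeg e U y v * (1 - \sum_(z in U | e v z) y z) ^+ 2.
Proof.
move=> sym irr tf vU y0 y1 xE.
set d := \sum_(z in U) y z in y1 *.
pose b u := \sum_(z in U | e u z) y z.
have b0 u : 0 <= b u by apply: sumr_ge0 => z _; exact: ltW.
have bd u : b u <= d.
  rewrite /b /d big_mkcondr/=; apply: ler_sum => z _; case: ifP => // _.
  exact: ltW.
have b1 u : 0 < 1 - b u by rewrite subr_gt0 (le_lt_trans (bd u)).
have x0 u : 0 < x u by rewrite xE divr_gt0// b1.
have -> : \sum_(z in U | v \in survivors e U z) y z * wdeg e (survivors e U z) x v +
    (1 - d) * wdeg e U x v =
    (\sum_(u in U | e v u) x u * (1 - b v - b u)) / x v.
  rewrite /wdeg mulrA; under eq_bigr do rewrite mulrA.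
  rewrite -big_distrl/= -mulrDl; congr (_ / _).
  have -> : \sum_(z in U | v \in survivors e U z)
      y z * (\sum_(u in survivors e U z | e v u) x u) =
    \sum_(u in U | e v u) x u *
      \sum_(z in U | (v \in survivors e U z) && (u \in survivors e U z)) y z.
    transitivity (\sum_(z in U | v \in survivors e U z) \sum_(u in U | e v u)
        (if u \in survivors e U z then x u * y z else 0)).
      apply: eq_bigr => z _; rewrite big_distrr/= -big_mkcondr/=.
      apply: eq_big => [u|u _]; last by rewrite mulrC.
      by rewrite !inE; case: (u \in U) => //=; rewrite andbC.
    rewrite exchange_big/=; apply: eq_bigr => u _.
    by rewrite big_distrr/= -big_mkcondr/=; apply: eq_bigl => z; rewrite andbA.
  rewrite big_distrr/= -big_split/=; apply: eq_bigr => u /andP[uU vu].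
  rewrite sum_both_survive// -/d -/(b u) -/(b v); ring.
rewrite -/(b v) /wdeg -/(b v) ler_pdivrMr// xE -/(b v).
have -> : b v / y v * (1 - b v) ^+ 2 * (y v / (1 - b v)) = b v * (1 - b v).
  by field; rewrite !gt_eqF//= ?y0//; exact: b1.
rewrite {3}/b big_distrl/=; apply: ler_sum => u /andP[uU vu].
rewrite xE -/(b u) -mulrA ler_wpM2l ?(ltW (y0 u))//.
(* This is [1 - b v - b u <= (1 - b v) * (1 - b u)]. *)
rewrite mulrC ler_pdivrMr//; have := mulr_ge0 (b0 u) (b0 v); lra.
Qed.

(** With probability [1 - d] nothing is selected and the gap stays [g]. The gap [d] after a
    selection costs at most [d ^+ 2] on average, and the second-order error of [shearer_step] at
    most another [d ^+ 2]. The hypotheses range over all weights because the weights change along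
    the way. *)
Lemma dominated_step (R : realType) (T : finType) (e : rel T) (U : {set T})
    (d g : R) :
  symmetric e -> irreflexive e -> triangle_free e ->
  U != finset.set0 -> 0 < d < 1 ->
  (forall z (x : T -> R), z \in U -> (forall u, 0 < x u) ->
    dominated e (survivors e U z)
      (fun v => shearer (wdeg e (survivors e U z) x v) - d)) ->
  (forall x : T -> R, (forall u, 0 < x u) ->
    dominated e U (fun v => shearer (wdeg e U x v) - g)) ->
  forall x : T -> R, (forall u, 0 < x u) ->
    dominated e U (fun v => shearer (wdeg e U x v) -
                            ((1 - d) * g + 2 * d ^+ 2)).
Proof.
move=> sym irr tf /finset.set0Pn[v0 v0U] /andP[d0 d1] IHW IHU t t0.
pose X := \sum_(z in U) t z.
have X0 : 0 < X.
  rewrite /X (bigD1 v0)//=; apply: ltr_pwDl => //.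
  by apply: sumr_ge0 => z _; exact: ltW.
pose y z := d / X * t z.
have y0 z : 0 < y z by rewrite mulr_gt0// divr_gt0.
have yd : \sum_(z in U) y z = d.
  by rewrite -big_distrr/= -/X divfK// gt_eqF.
pose b u := \sum_(z in U | e u z) y z.
have b0 u : 0 <= b u by apply: sumr_ge0 => z _; exact: ltW.
have bd u : b u <= d.
  rewrite /b -yd big_mkcondr/=; apply: ler_sum => z _; case: ifP => // _.
  exact: ltW.
pose x u := y u / (1 - b u).
have x0 u : 0 < x u by rewrite divr_gt0// subr_gt0 (le_lt_trans (bd u)).
have ywdeg v : wdeg e U t v = wdeg e U y v.
  rewrite /wdeg -big_distrr/= invfM mulrACA mulfV ?mul1r//.
  by rewrite gt_eqF// divr_gt0.
apply: (dominated_le _ (@dominated_mix R T e U y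
  (fun v => shearer (wdeg e U x v) - g)
  (fun z v => if v == z then 1 else if v \in survivors e U z
    then shearer (wdeg e (survivors e U z) x v) - d else 0) _ _ _ _)).
- move=> v vU; rewrite yd ywdeg.
  have D0 : 0 <= wdeg e U y v by exact: wdeg_ge0.
  have [s1 sD] := shearer_exponentP D0.
  rewrite {1}/shearer; set D := wdeg e U y v in D0 s1 sD *.
  set s := shearer_exponent D in s1 sD *.
  pose a := 2 * expR (- s) - expR s * expR (- s) ^+ 2 / s.
  pose k := expR (- s) ^+ 2 / s.
  have k0 : 0 <= k by rewrite divr_ge0 ?sqr_ge0//; lra.
  (* One tangent line, taken at the old degree [D], serves every outcome; the bound is then linear
     in the new degree and can be averaged. *)
  have tang r : 0 <= r -> a - k * r <= shearer r.
    move=> r0; apply: le_trans (shearer_ge_tangent s1 r0).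
    by rewrite le_eqVlt; apply/orP; left; apply/eqP; rewrite /a /k; ring.
  have step := shearer_step s1 (ltW (y0 v)) (esym sD) (erefl a) (erefl k).
  have yD : y v * D = b v by rewrite /D /wdeg mulrCA mulfV ?mulr1// gt_eqF.
  rewrite yD in step.
  have avg := expected_wdeg sym irr tf vU y0 (eq_ind_r (fun r => r < 1) d1 yd)
    (fun u => erefl (x u)).
  rewrite yd -/(b v) -/D in avg.
  have ms := sum_survives y sym irr vU; rewrite yd -/(b v) in ms.
  set E := \sum_(z in U | v \in survivors e U z) y z * wdeg _ _ _ _ in avg.
  have sumE : y v + (a - d) * (d - y v - b v) - k * E <=
      \sum_(z in U) y z * (if v == z then 1 else if v \in survivors e U z
        then shearer (wdeg e (survivors e U z) x v) - d else 0).
    rewrite (bigD1 v)//= eqxx mulr1 -addrA lerD2l.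
    rewrite -ms big_distrr/= /E big_distrr/= -sumrB.
    rewrite [leLHS]big_mkcondr/= [leRHS]big_mkcondr/=.
    apply: ler_sum => z zU; have [->|zv] := eqVneq z v.
      by rewrite !inE eqxx andbF.
    rewrite /=; case: ifP => _; last by rewrite mulr0.
    have := tang _ (wdeg_ge0 e (survivors e U z) v x0).
    have := y0 z; nra.
  have own := tang _ (wdeg_ge0 e U v x0).
  have bsq : b v ^+ 2 <= d ^+ 2 by rewrite ler_sqr ?nnegrE// ltW.
  have kavg := ler_wpM2l k0 avg; rewrite mulrDr in kavg.
  have yv := y0 v; have bv := b0 v.
  have own' : (1 - d) * (a - k * wdeg e U x v) <= (1 - d) * shearer (wdeg e U x v).
    by rewrite ler_wpM2l// subr_ge0 ltW.
  apply: le_trans (lerD (lexx _) sumE).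
  nra.
- by move=> z; exact: ltW.
- by rewrite yd ltW.
- exact: IHU.
- move=> z zU; apply: dominated_add_vertex => //.
  exact: IHW.
Qed.

(** The outer induction on the size of [U] gives any positive gap on the survivors. The inner one
    lowers the gap on [U] itself, from the trivial value 1 through [8 / (8 + k)]. *)
Lemma dominated_shearer (R : realType) (T : finType) (e : rel T) (U : {set T})
    (g : R) (x : T -> R) :
  symmetric e -> irreflexive e -> triangle_free e -> 0 < g ->
  (forall u, 0 < x u) ->
  dominated e U (fun v => shearer (wdeg e U x v) - g).
Proof.
move=> sym irr tf; move: {2}#|U|.+1 (ltnSn #|U|) => n.
elim: n U g x => // n IHn U g x Un g0 x0.
have [->|U0] := eqVneq U finset.set0.
  by apply: dominated0 => v; rewrite finset.in_set0.
have gap k (t : T -> R) : (forall u, 0 < t u) ->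
    dominated e U (fun v => shearer (wdeg e U t v) - 8 / (8 + k%:R)).
  elim: k t => [|k IHk] t t0.
    apply: dominated0 => v _; rewrite addr0 divff ?subr_le0 ?pnatr_eq0//.
    by rewrite shearer_le1// wdeg_ge0.
  have k0 : 0 <= k%:R :> R by rewrite ler0n.
  pose g' : R := 8 / (8 + k%:R).
  have g'0 : 0 < g' by rewrite divr_gt0//; lra.
  have g'1 : g' <= 1 by rewrite ler_pdivrMr; lra.
  (* The step size [g' / 4] minimises [(1 - d) * g' + 2 * d ^+ 2]. *)
  apply: (dominated_le _ (@dominated_step R T e U (g' / 4) g' sym irr tf U0 _ _
    IHk t t0)).
  - move=> v _; rewrite lerD2l lerN2 -[k.+1%:R]natr1.
    rewrite -subr_ge0 /g'.
    have -> : 8 / (8 + (k%:R + 1)) - ((1 - 8 / (8 + k%:R) / 4) * (8 / (8 + k%:R))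
      + 2 * (8 / (8 + k%:R) / 4) ^+ 2) =
      8 / ((8 + k%:R) ^+ 2 * (9 + k%:R)) :> R.
      by field; rewrite !gt_eqF//; lra.
    by rewrite divr_ge0// mulr_ge0// ?sqr_ge0//; lra.
  - by lra.
  - move=> z w zU w0; apply: IHn => //; last by lra.
    rewrite -ltnS; apply: leq_trans Un; rewrite ltnS fintype.proper_card//.
    apply/fintype.properP; split.
      by apply/fintype.subsetP => u; rewrite inE => /andP[].
    by exists z => //; rewrite !inE eqxx andbF.
have [k kg] : exists k : nat, 8 / (8 + k%:R) <= g.
  exists (Num.truncn (8 / g)).+1.
  have k0 : 0 <= (Num.truncn (8 / g)).+1%:R :> R by rewrite ler0n.
  rewrite ler_pdivrMr ?(ltr_wpDr k0)//.
  have := truncnS_gt (8 / g); rewrite ltr_pdivrMr// => h; nra.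
apply: dominated_le (gap k x x0) => v _; rewrite lerD2l lerN2//.
Qed.

(** * Weights from the spectral radius *)

Definition sqnorm (R : realType) (n : nat) (y : 'rV[R]_n) : R :=
  (y *m y^T) ord0 ord0.

Definition qform (R : realType) (n : nat) (A : 'M[R]_n) (y : 'rV[R]_n) : R :=
  (y *m A *m y^T) ord0 ord0.

Lemma sqnormE (R : realType) (n : nat) (y : 'rV[R]_n) :
  sqnorm y = \sum_i y ord0 i ^+ 2.
Proof.
by rewrite /sqnorm mxE; apply: eq_bigr => i _; rewrite mxE expr2.
Qed.

Lemma sqnorm_ge0 (R : realType) (n : nat) (y : 'rV[R]_n) : 0 <= sqnorm y.
Proof. by rewrite sqnormE; apply: sumr_ge0 => i _; exact: sqr_ge0. Qed.

Lemma sqnorm_eq0 (R : realType) (n : nat) (y : 'rV[R]_n) :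
  sqnorm y = 0 -> y = 0.
Proof.
rewrite sqnormE => /eqP; rewrite psumr_eq0 => [/allP y0|i _]; last exact: sqr_ge0.
apply/rowP => i; rewrite mxE; apply/eqP; rewrite -sqrf_eq0.
by have := y0 i (mem_index_enum i).
Qed.

Lemma qformZ (R : realType) (n : nat) (A : 'M[R]_n) (a : R) (y : 'rV[R]_n) :
  qform A (a *: y) = a ^+ 2 * qform A y.
Proof.
by rewrite /qform linearZ/= -!scalemxAl -scalemxAr !mxE mulrA expr2.
Qed.

Lemma qform_scalar_sub (R : realType) (n : nat) (A : 'M[R]_n) (a : R)
    (y : 'rV[R]_n) :
  qform (a%:M - A) y = a * sqnorm y - qform A y.
Proof.
by rewrite /qform /sqnorm mulmxBr mulmxBl mul_mx_scalar -scalemxAl !mxE.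
Qed.

Lemma continuous_qform (R : realType) (n : nat) (A : 'M[R]_n) :
  continuous (qform A).
Proof.
have -> : qform A = fun y => \sum_j \sum_i y ord0 i * A i j * y ord0 j.
  apply/funext => y; rewrite /qform mxE; apply: eq_bigr => j _.
  by rewrite !mxE big_distrl.
have cont_sum (F : 'I_n -> 'rV[R]_n -> R) : (forall i, continuous (F i)) ->
    continuous (fun y => \sum_i F i y).
  move=> cF; apply: continuous_big => //; exact: add_continuous.
apply: (cont_sum _) => j; apply: (cont_sum _) => i y.
have cg k : continuous (fun z : 'rV[R]_n => z ord0 k) by exact: coord_continuous.
exact: (cvgM (cvgM (cg i y) (cvg_cst (A i j))) (cg j y)).
Qed.

(** If [h = c *m H] were nonzero, a small move from [c] against [h] would make the form negative.
    The step length divides by [qform H h + 1] because [qform H h] may vanish. *)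
Lemma qform_eq0_ker (R : realType) (n : nat) (H : 'M[R]_n) (c : 'rV[R]_n) :
  H^T = H -> (forall y, 0 <= qform H y) -> qform H c = 0 -> c *m H = 0.
Proof.
move=> Hs Hp c0; set h := c *m H; apply: sqnorm_eq0.
have expand t : qform H (c + t *: h) = 2 * t * sqnorm h + t ^+ 2 * qform H h.
  have E : h *m H *m c^T = h *m h^T by rewrite /h trmx_mul Hs mulmxA.
  rewrite /qform linearD/= linearZ/= !mulmxDl !mulmxDr.
  rewrite -!scalemxAl -!scalemxAr E -/h.
  have := c0; rewrite /qform -/h !mxE => c0'.
  by rewrite /sqnorm /qform !mxE c0' ; ring.
have Q0 := Hp h; have g0 := sqnorm_ge0 h.
have := Hp (c - (sqnorm h / (qform H h + 1)) *: h).
rewrite -scaleNr expand; set g := sqnorm h in g0 *; set Q := qform H h in Q0 *.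
have -> : 2 * - (g / (Q + 1)) * g + (- (g / (Q + 1))) ^+ 2 * Q =
  - (g ^+ 2 * (Q + 2) / (Q + 1) ^+ 2) by field; rewrite gt_eqF// ltr_wpDl.
rewrite oppr_ge0 pmulr_lle0 ?invr_gt0 ?exprn_gt0 ?ltr_wpDl//.
rewrite pmulr_lle0 ?ltr_wpDl//.
by move=> g2; apply/eqP; rewrite -sqrf_eq0 eq_le g2 sqr_ge0.
Qed.

(** Let [c] maximise the form on the unit sphere, with value [l]. Then [l%:M - A] is positive
    semidefinite and its form vanishes at [c], so [c] is an eigenvector. *)
Lemma rayleigh (R : realType) (n : nat) (A : 'M[R]_n.+1) : A^T = A ->
  exists2 l, eigenvalue A l & forall y, qform A y <= l * sqnorm y.
Proof.
move=> As; pose K := [set y : 'rV[R]_n.+1 | sqnorm y = 1].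
have sqE : (@sqnorm R n.+1) = qform 1%:M.
  by apply/funext => y; rewrite /qform mulmx1.
have cK : compact K.
  have cB : compact [set v : 'rV[R]_n.+1 | forall i, v ord0 i \in `[-1, 1]].
    apply: (@rV_compact _ _ (fun=> `[(-1 : R), 1]%classic)) => _.
    exact: segment_compact.
  apply: subclosed_compact cB _.
    apply: (@preimage_closed _ _ (@sqnorm R n.+1) [set x | x = 1]).
      by move=> v _; rewrite sqE; exact: continuous_qform.
    exact: closed_eq.
  move=> v vK i; rewrite in_itv/= -ler_norml -(@expr_le1 _ 2)// real_normK ?num_real//.
  rewrite -[leRHS]vK sqnormE (bigD1 i)//= lerDl sumr_ge0// => j _.
  exact: sqr_ge0.
have [||c cK' cmax] := @EVT_max_rV R n.+1 (qform A) K _ cK.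
- exists (delta_mx ord0 ord0); rewrite /K/= sqnormE (bigD1 ord0)//= mxE !eqxx.
  rewrite expr1n big1 ?addr0// => i i0; rewrite mxE (negbTE i0) andbF.
  by rewrite expr0n.
- by apply: continuous_subspaceT; exact: continuous_qform.
have c1 : sqnorm c = 1 by move: cK'; rewrite inE.
have qle y : qform A y <= qform A c * sqnorm y.
  have [->|y0] := eqVneq y 0.
    by rewrite sqE -(scale0r 0) !qformZ expr0n !mul0r mulr0.
  have N0 : 0 < sqnorm y.
    rewrite lt_neqAle sqnorm_ge0 andbT eq_sym; apply: contra_neq y0.
    exact: sqnorm_eq0.
  pose a := (Num.sqrt (sqnorm y))^-1.
  have a2 : a ^+ 2 * sqnorm y = 1.
    by rewrite exprVn sqr_sqrtr ?ltW// mulVf ?gt_eqF.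
  have := cmax (a *: y); rewrite inE /K/= {1}sqE qformZ -sqE => /(_ a2).
  rewrite qformZ => h.
  have := ler_wpM2r (ltW N0) h; rewrite mulrAC a2 mul1r//.
exists (qform A c) => //; apply/eigenvalueP; exists c; last first.
  apply: contra_eq_neq c1 => ->.
  by rewrite sqE -(scale0r 0) qformZ expr0n mul0r eq_sym oner_eq0.
apply/eqP; rewrite eq_sym -subr_eq0 -mul_mx_scalar -mulmxBr; apply/eqP.
apply: qform_eq0_ker.
- by rewrite linearB/= tr_scalar_mx As.
- by move=> y; rewrite qform_scalar_sub subr_ge0.
- by rewrite qform_scalar_sub c1 mulr1 subrr.
Qed.

Lemma eigenvalue_le_spectral_radius (R : realType) (n : nat) (A : 'M[R]_n)
    (l : R) : eigenvalue A l -> l <= spectral_radius A.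
Proof.
move=> /eigenvalueP[v vA v0].
pose B := map_mx (real_complex R) A.
apply: (@le_trans _ _ (ComplexField.Normc.normc (real_complex R l))).
  by rewrite /= expr0n/= addr0 sqrtr_sqr ler_norm.
apply: ub_le_sup; last first.
  exists (real_complex R l) => //=; apply/eigenvalueP.
  exists (map_mx (real_complex R) v); last by rewrite map_mx_eq0.
  by rewrite -map_mxM vA map_mxZ.
(* The supremum needs a bounded set: each eigenvalue is a root of the characteristic polynomial, so
   the sum of the moduli of the roots is a bound. *)
have [rs rsE] := closed_field_poly_normal (char_poly B).
exists (\sum_(z <- rs) ComplexField.Normc.normc z) => _ [z zB <-].
have norm0 w : 0 <= ComplexField.Normc.normc w :> R by case: w => a b; exact: sqrtr_ge0.
have : root (char_poly B) z by rewrite -eigenvalue_root_char.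
rewrite rsE rootZ ?lead_coef_eq0 ?monic_neq0 ?char_poly_monic//.
rewrite root_prod_XsubC => zrs.
by rewrite (big_rem z)//= lerDl sumr_ge0.
Qed.

(* [M := r%:M - A] is a positive definite M-matrix: testing [x *m M = 1] against
   the negative part [y] of [x] gives [qform M y <= 0], hence [y = 0]. *)
Lemma positive_supersolution (R : realType) (n : nat) (A : 'M[R]_n) (r : R) :
  A^T = A -> (forall i j, 0 <= A i j) -> 0 <= r -> spectral_radius A < r ->
  exists2 x : 'rV[R]_n, (forall i, 0 < x ord0 i) &
    forall i, (x *m A) ord0 i <= r * x ord0 i.
Proof.
case: n A => [|n] A As A0 r0 Ar; first by exists 0 => -[].
have [l lA lq] := rayleigh As.
have lr : l < r by apply: le_lt_trans Ar; exact: eigenvalue_le_spectral_radius.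
pose M := r%:M - A.
have Mpos y : qform M y <= 0 -> y = 0.
  rewrite qform_scalar_sub => h; apply: sqnorm_eq0.
  have := lq y; have := sqnorm_ge0 y; nra.
have Mu : M \in unitmx.
  rewrite -row_free_unit -kermx_eq0; apply/eqP/row_matrixP => i.
  rewrite row0; apply: Mpos; rewrite /qform.
  by rewrite -row_mul mulmx_ker row0 mul0mx mxE.
have [x xM] : exists x : 'rV[R]_n.+1, x *m M = const_mx 1.
  by exists (const_mx 1 *m invmx M); rewrite mulmxKV.
pose y : 'rV[R]_n.+1 := \row_i Num.max 0 (- x ord0 i).
have y0 i : 0 <= y ord0 i by rewrite mxE le_max lexx.
have xA i : r * x ord0 i = (x *m A) ord0 i + 1.
  have /(congr1 (fun B : 'rV[R]_n.+1 => B ord0 i)) :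
      r *: x = x *m A + const_mx 1.
    by rewrite -xM mulmxBr mul_mx_scalar addrC subrK.
  by rewrite [LHS]mxE [RHS]mxE [const_mx _ _ _]mxE.
have yN : y = 0.
  apply: Mpos.
  pose z : 'rV[R]_n.+1 := x + y.
  have z0 i : 0 <= z ord0 i by rewrite !mxE; case: (leP 0 (- x ord0 i)) => h; lra.
  have yz i : y ord0 i * z ord0 i = 0 by rewrite !mxE; case: leP => _; ring.
  have xMy : 0 <= (x *m M *m y^T) ord0 ord0.
    by rewrite xM mxE sumr_ge0// => i _; rewrite !mxE mul1r le_max lexx.
  (* The positive part [z] and the negative part [y] have disjoint supports, so only [- A]
     contributes. *)
  have zMy : (z *m M *m y^T) ord0 ord0 <= 0.
    rewrite mulmxBr mul_mx_scalar mulmxBl -scalemxAl.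
    have -> : z *m y^T = 0.
      apply/matrixP => a b; rewrite !ord1 !mxE big1// => i _.
      by rewrite mulrC [y^T _ _]mxE yz.
    rewrite scaler0 sub0r mxE oppr_le0 mxE sumr_ge0// => i _.
    rewrite mulr_ge0 ?[y^T _ _]mxE// mxE sumr_ge0// => j _.
    by rewrite mulr_ge0.
  have -> : qform M y = (z *m M *m y^T) ord0 ord0 - (x *m M *m y^T) ord0 ord0.
    by rewrite /qform /z !mulmxDl [X in X - _]mxE addrAC subrr add0r.
  lra.
have x0 i : 0 <= x ord0 i.
  have /(congr1 (fun B : 'rV[R]_n.+1 => B ord0 i)) := yN.
  by rewrite !mxE; case: (leP 0 (- x ord0 i)) => h; lra.
have xA0 i : 0 <= (x *m A) ord0 i.
  by rewrite mxE sumr_ge0// => j _; rewrite mulr_ge0.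
exists x => i; last by rewrite xA lerDl.
(* A zero entry would give [0 = (x *m A) ord0 i + 1 >= 1]. *)
rewrite lt_neqAle x0 andbT eq_sym; apply/eqP => xi0.
by have := xA i; rewrite xi0 mulr0; have := xA0 i; lra.
Qed.

Lemma positive_weights (R : realType) (T : finType) (e : rel T) (r : R) :
  symmetric e -> 0 <= r -> graph_spectral_radius R e < r ->
  exists2 x : T -> R, (forall u, 0 < x u) &
    forall v, wdeg e [set: T]%SET x v <= r.
Proof.
move=> sym r0 er.
have [|i j|x x0 xr] := @positive_supersolution R _ (adjacency_mx R e) r _ _ r0 er.
- by apply/matrixP => i j; rewrite !mxE sym.
- by rewrite mxE ler0n.
exists (fun u => x ord0 (enum_rank u)) => // v.
rewrite /wdeg ler_pdivrMr//; apply: le_trans (xr _).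
rewrite mxE (reindex (@enum_rank T))/=; last first.
  by exists enum_val => i _; [exact: enum_rankK|exact: enum_valK].
rewrite le_eqVlt; apply/orP; left; apply/eqP.
rewrite (eq_bigl (e v)) => [|u]; last by rewrite finset.in_setT.
rewrite big_mkcond/=; apply: eq_bigr => u _; rewrite mxE !enum_rankK sym.
by case: ifP; rewrite ?mulr1 ?mulr0.
Qed.

(** * The bound *)

(** Both strict inequalities provide slack: the first for the existence of positive weights, the
    second for the gap [g = expR (- s) - r^-1]. *)
Lemma fractional_colorable_shearer (R : realType) (T : finType) (e : rel T)
    (s r : R) :
  symmetric e -> irreflexive e -> triangle_free e -> 1 <= s ->
  graph_spectral_radius R e < expR s * (s - 1) -> expR s < r ->
  fractional_colorable e r.
Proof.
move=> sym irr tf s1 es sr.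
have e1 : 1 <= expR s by rewrite -expR0 ler_expR; lra.
have r0 : 0 < r by lra.
have [|x x0 xD] := @positive_weights R T e (expR s * (s - 1)) sym _ es.
  by rewrite mulr_ge0 ?expR_ge0//; lra.
have g0 : 0 < expR (- s) - r^-1.
  by rewrite subr_gt0 expRN ltf_pV2 ?posrE ?expR_gt0.
have [P [P0 Ps P1 Pp]] := dominated_shearer [set: T]%SET sym irr tf g0 x0.
split; first by lra.
exists [ffun I => P I].
  split=> [I|I nI|]; first by rewrite ffunE.
    by rewrite ffunE Ps// (negbTE nI).
  by rewrite -P1; apply: eq_bigr => I _; rewrite ffunE.
move=> v; under eq_bigr do rewrite ffunE.
apply: le_trans (Pp v (finset.in_setT v)).
have D0 := wdeg_ge0 e [set: T]%SET v x0.
have := shearer_ge_tangent s1 D0; have := shearer_tangent_eq s1.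
set D := wdeg _ _ _ _ in D0 *; have DD : D <= expR s * (s - 1) := xD v.
have k0 : 0 <= expR (- s) ^+ 2 / s by rewrite divr_ge0 ?sqr_ge0//; lra.
have := ler_wpM2r k0 DD.
rewrite !mulrDl -!mulrA; lra.
Qed.

Lemma fractional_chromatic_le_expR (R : realType) (T : finType) (e : rel T)
    (s : R) :
  symmetric e -> irreflexive e -> triangle_free e -> 1 <= s ->
  graph_spectral_radius R e <= expR s * (s - 1) ->
  fractional_chromatic R e <= expR s.
Proof.
move=> sym irr tf s1 es; apply/ler_addgt0Pr => d d0.
have a0 := expR_gt0 s; pose r := expR s + d; have r0 : 0 < r by rewrite addr_gt0.
have sr : s < ln r by rewrite -ltr_expR lnK ?posrE// ltrDl.
apply: (fractional_chromatic_min R irr).2.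
(* Any exponent strictly between [s] and [ln r] makes both inequalities strict. *)
apply: (@fractional_colorable_shearer R T e ((s + ln r) / 2)) => //.
- lra.
- apply: le_lt_trans es _.
  have : expR s < expR ((s + ln r) / 2) by rewrite ltr_expR; lra.
  nra.
- by rewrite -/r -[ltRHS]lnK ?posrE// ltr_expR; lra.
Qed.

(** Writing [r = expR (1 + t) * t] turns the quantity into [(1 + ln t) / t], and [t] grows with
    [r]. *)
Lemma ln_div_shearer_exponent_cvg (R : realType) :
  ln r / (shearer_exponent r - 1) - 1 @[r --> +oo] --> (0 : R).
Proof.
apply/cvgr0Pnorm_le => d d0.
(* With [u] the square root of [t], [1 + ln t <= 2 * u - 1 <= d * t] as soon as [d * u >= 2], that
   is [t >= 4 / d ^+ 2]. The threshold for [r] below is its value at [t = K]. *)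
pose K : R := 1 + 4 / d ^+ 2.
have q0 : 0 < 4 / d ^+ 2 by rewrite divr_gt0// exprn_gt0.
have K1 : 1 < K by rewrite /K; lra.
exists (expR (1 + K) * K); split; first exact: num_real.
move=> r rK.
have r0 : 0 <= r by have := expR_gt0 (1 + K); nra.
have [s1 sr] := shearer_exponentP r0.
pose t := shearer_exponent r - 1.
have sE : shearer_exponent r = 1 + t by rewrite /t; ring.
rewrite sE in s1 sr *; rewrite [1 + t - 1]addrC addKr in sr *.
have Kt : K < t.
  rewrite ltNge; apply/negP => tK; move: rK; rewrite -sr ltNge => /negP; apply.
  by apply: ler_pM; rewrite ?expR_ge0 ?ler_expR; lra.
have t0 : 0 < t by lra.
have -> : ln r / t - 1 = (1 + ln t) / t.
  by rewrite -sr lnM ?posrE ?expR_gt0// expRK; field; rewrite gt_eqF.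
have lnt0 : 0 <= ln t by rewrite ln_ge0//; lra.
rewrite ger0_norm ?divr_ge0//; [|lra|lra].
pose u := Num.sqrt t.
have u0 : 0 < u by rewrite sqrtr_gt0.
have ut : u ^+ 2 = t by rewrite sqr_sqrtr// ltW.
have lnu : ln u <= u - 1.
  by have := @le_ln1Dx R (u - 1); rewrite [1 + _]addrC subrK; apply; lra.
have lntu : ln t = ln u + ln u by rewrite -ut expr2 lnM ?posrE.
rewrite ler_pdivrMr//.
have du : 2 <= d * u.
  rewrite -(@ler_pXn2r _ 2) ?nnegrE ?mulr_ge0 ?(ltW d0) ?(ltW u0)//.
  rewrite exprMn ut.
  have : 4 / d ^+ 2 <= t by rewrite /K in Kt; lra.
  rewrite ler_pdivrMr ?exprn_gt0// mulrC; lra.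
rewrite lntu -ut expr2 mulrA; nra.
Qed.

Theorem theorem1p6 (R : realType) :
  exists eps : R -> R,
    eps rho @[rho --> +oo] --> (0 : R) /\
    forall (T : finType) (e : rel T),
      symmetric e -> irreflexive e -> triangle_free e ->
      1 < graph_spectral_radius R e ->
      fractional_chromatic R e <=
        (1 + eps (graph_spectral_radius R e)) *
        (graph_spectral_radius R e / ln (graph_spectral_radius R e)).
Proof.
(* Chosen so that the right side is exactly [r / (s - 1) = expR s] with [s = shearer_exponent r]. *)
exists (fun r => ln r / (shearer_exponent r - 1) - 1).
split; first exact: ln_div_shearer_exponent_cvg.
move=> T e sym irr tf; set r := graph_spectral_radius R e => r1.
have [s1 sr] := shearer_exponentP (ltW (lt_trans ltr01 r1)).
set s := shearer_exponent r in s1 sr *.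
have lnr : ln r != 0 by rewrite gt_eqF// ln_gt0.
have s1' : s - 1 != 0.
  by apply/eqP => s0; move: r1; rewrite -sr s0 mulr0 ltNge ler01.
have -> : (1 + (ln r / (s - 1) - 1)) * (r / ln r) = r / (s - 1).
  by field; rewrite lnr s1'.
rewrite -{1}sr mulfK//.
by apply: fractional_chromatic_le_expR => //; rewrite sr.
Qed.
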